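(* Let $\mathcal D$ be a data cube with protected measures $\mu_1,\dots,\mu_k$ and computed measures $\tau_1,\dots,\tau_l$, let $D_i$ be one of its dimensions, and let $H$ be a hierarchy over $D_i$ ending in a node (level) $\ell$. Let $\{(\alpha_j,f_j)\mid j=1,2,\dots,r\}$ be a set of selected measures $\alpha_j$, taken from $\mu_1,\dots,\mu_k,\tau_1,\dots,\tau_l$, with their associated aggregation functions $f_j\in\{\mathsf{SUM},\mathsf{AVG},\mathsf{MIN},\mathsf{MAX},\mathsf{COUNT},\mathsf{COUNT\text{-}DISTINCT}\}$. Then the operation $\mathsf{ROLL\text{-}UP}(\mathcal D,D_i,H(\ell),\{(\alpha_j,f_j)\mid j=1,2,\dots,r\})$ is expressible as an OLAP operation.
   Context: **Dimensions.** A dimension $D$ has a schema $\sigma(D)$: a finite lattice, viewed as a directed graph of levels, with a unique top node $All$ (only incoming edges) and a unique bottom node $Bottom$ (only outgoing edges), all maximal-length paths going from $Bottom$ to $All$. A path from $Bottom$ to $All$ is a hierarchy of $\sigma(D)$; ''a hierarchy $H$ over $D$ ending in $\ell$'' refers to the initial part, from $Bottom$ to $\ell$, of a hierarchy $H$ containing $\ell$. Each level $\ell$ has a non-empty finite set $dom(D.\ell)$, with $dom(D.All)=\{all\}$ and $dom(D.Bottom)=dom(D)$, and $dom(D)$ is totally ordered by $<$. A dimension graph $I(\sigma(D))$ is a directed acyclic graph with node set $\bigcup_\ell dom(D.\ell)$, in which an edge from $a\in dom(D.\ell)$ to $a'\in dom(D.\ell')$ can exist only if $\ell\to\ell'$ is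 an edge of $\sigma(D)$. For each hierarchy $H$, the subgraph $I_H(\sigma(D))$ on the nodes belonging to the levels of $H$ is a directed tree, directed towards its root $all$. Write $\rho_H(a,b)$ (''$a$ rolls up to $b$'') if $b$ is reachable from $a$ in $I_H(\sigma(D))$ (with $a$ rolling up to itself), and $\rho$ if $H$ is clear from the context. Dimension graphs are sound: for every level $\ell$, hierarchies $H_1,H_2$ reaching $\ell$ from $Bottom$, $a\in dom(D)$ and $b_1,b_2\in dom(D.\ell)$, $\rho_{H_1}(a,b_1)$ and $\rho_{H_2}(a,b_2)$ imply $b_1=b_2$. Every $b\in dom(D.\ell)$ has at least one $a\in dom(D)$ with $\rho(a,b)$; $rep(b)$ denotes the smallest such $a$. Put $b_1<b_2$ in $dom(D.\ell)$ iff $rep(b_1)<rep(b_2)$. **Data cubes.** A $d$-dimensional data cube $\mathcal D$ ($d\ge1$) consists of: the matrix $M(\mathcal D)=dom(D_1)\times\cdots\times dom(D_d)$, whose elements are called cells; sound dimension graphs $I(\sigma(D_i))$; protected measures $\mu_1,\dots,\mu_k$ and computed measures $\tau_1,\dots,\tau_l$ ($l\ge0$), which are functions from the cells to $\mathbb Q$; and a flag $\varphi$ from the cells to $\{0,1\}$. Some cells may be empty (destroyed): they carry no measures and no flag, they are ignored in all computations, and no measure is ever added to them. **Prime labels.** These are the numbers $1,\sqrt2,\sqrt3,\sqrt5,\sqrt7,\dots,\sqrt{p_n},\dots$ ($p_n$ the $n$-th prime), used symbolically; intermediate computed measures may have values involving them. A prime product label is a product of prime labels coming from labelings of different dimensions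 that use disjoint sets of labels. If the label of a cell is the product of labels for the dimensions with index in $I\subseteq\{1,\dots,d\}$, then for a rational-valued measure $\mu$ the sum over all non-empty cells of $\mu$ times the label is called a (full or partial) prime sum; it can be written $\sum_w a_w w$, with $w$ ranging over the labels that occur. **Atomic OLAP transformations.** Each creates, in all non-empty cells $(x_1,\dots,x_d)$, a new measure $\tau_{new}$ from the existing measures; $\alpha,\beta$ denote existing (protected or computed) measures. - Arithmetic: $\tau_{new}=c$ with $c\in\mathbb Q$; $\tau_{new}=\alpha+\beta$; $\tau_{new}=\alpha\cdot\beta$; $\tau_{new}=\alpha/\beta$, with the convention $a/0:=a$. - Boolean (values $0/1$, cell per cell): $(\alpha=\beta)$; $(\alpha<\beta)$; $(\ell=c)$ for a level $\ell$ of $\sigma(D_i)$ and $c\in dom(D_i.\ell)$, equal to $1$ iff $\rho(x_i,c)$; $(\ell<_\ell c)$, equal to $1$ iff $x_i$ rolls up to some $b\in dom(D_i.\ell)$ with $b<_\ell c$, where $<_\ell$ is any order defined on level $\ell$; similarly $(c<_\ell \ell)$. - Selectors: the constant selector $\sigma_{D_i.\ell=c}$, which equals the test $(\ell=c)$; the level selector $\sigma_{D_i.\ell}$, equal to $1$ iff $x_i=rep(b)$ for some $b\in dom(D_i.\ell)$, and $0$ otherwise. - Global aggregates (the same value in all non-empty cells): $\#_{\neq}(\alpha)$, the number of distinct values of $\alpha$ in the matrix; $\mathrm{SUM}_d(\alpha)$, the sum of $\alpha$ over all non-empty cells; $\min(\alpha)$; $\max(\alpha)$. - Grouped aggregates: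 if $\tau_m$ is a prime (product) labeling of the cells, then $\#_{\neq}|_{\tau_m}(\alpha)$, $\min|_{\tau_m}(\alpha)$ and $\max|_{\tau_m}(\alpha)$ are, in each cell $x$, the number of distinct values, minimum and maximum of $\alpha$ over the cells having the same label as $\tau_m(x)$. - Grouping: $\gamma_{D_i.\ell}$, where $dom(D_i.\ell)=\{b_1<\dots<b_s\}$: the next $s$ prime labels not yet used by earlier transformations are assigned in order to $b_1,\dots,b_s$, and a cell with $\rho(x_i,b_j)$ receives the label of $b_j$. Projection of a prime sum $\tau_m|_{\tau_n}$: if $\tau_m$ is a prime sum $\sum_w a_w w$ over the labels of an earlier prime (product) labeling $\tau_n$, the new measure has value $a_w$ in each cell where $\tau_n=w$. **OLAP operation (of arity $m$).** It is a finite sequence of $n$ atomic transformations creating $\tau_{l+1},\dots,\tau_{l+n}$, followed by the creation of a Boolean measure $\varphi^{(m)}$ (the output flag), optionally preceded by the creation of a Boolean measure $\delta$ (a destructor); $\delta$ and $\varphi^{(m)}$ are created by atomic transformations or set equal to existing Boolean measures. In the output cube, dimensions, schemas and dimension graphs are unchanged; cells with $\delta=0$ are emptied (even of their protected measures); in the other non-empty cells the measures are $\mu_1,\dots,\mu_k$, the last $m$ computed measures $\tau_{l+n-m+1},\dots,\tau_{l+n}$ (renamed $\tau_1,\dots,\tau_m$), and the new flag $\varphi^{(m)}$ replacing the old one. An operation on data cubes is expressible as an OLAP operation if there is an OLAP operation (its sequence of transformations being chosen from the parameters of the operation, the numbers of measures, and the dimension schemas and graphs) whose output on the input cube is the output of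 the operation. **Roll-Up.** $\mathsf{ROLL\text{-}UP}(\mathcal D,D_i,H(\ell),\{(\alpha_j,f_j)\mid j=1,\dots,r\})$ computes, as computed output measures, for $j=1,\dots,r$, $\alpha_j^{f_j}(x_1,\dots,x_d)=f_j(\{\alpha_j(x_1,\dots,x_{i-1},y_i,x_{i+1},\dots,x_d)\mid y_i\in dom(D_i),\ \rho_H(y_i,b)\})$ (a multiset of values over non-empty cells), for all non-empty cells $(x_1,\dots,x_d)$, where $b\in dom(D_i.\ell)$ is such that $\rho_H(x_i,b)$. Here $\mathsf{SUM},\mathsf{AVG},\mathsf{MIN},\mathsf{MAX},\mathsf{COUNT},\mathsf{COUNT\text{-}DISTINCT}$ are the usual SQL aggregates: sum, average, minimum, maximum, number of values, number of distinct values. Protected measures are kept, no cell is destroyed, and the output flag is $1$ exactly on the non-empty cells for which $x_i=rep(b)$ for some $b\in dom(D_i.\ell)$. *)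

(* Defs.v *)
From HB Require Import structures.
From mathcomp Require Import all_boot all_order all_algebra.

Set Implicit Arguments.
Unset Strict Implicit.
Unset Printing Implicit Defensive.

Import Order.TTheory GRing.Theory Num.Theory.
Local Open Scope ring_scope.

(* A schema is a finite bounded lattice seen as its Hasse diagram. Hence All is
   \top, Bottom is \bot, and every maximal path runs from \bot to \top. *)
Definition level_edge (d : Order.disp_t) (L : finTBLatticeType d) : rel L :=
  fun x y => (x < y)%O && ~~ [exists z, (x < z)%O && (z < y)%O].

Definition is_hierarchy (d : Order.disp_t) (L : finTBLatticeType d)
    (H : seq L) : bool :=
  if H is x :: p
  then [&& x == \bot%O, path (@level_edge d L) x p & last x p == \top%O]
  else false.

(* The nodes of a dimension graph form the disjoint union of the level domains,
   so that each node remembers its level. *)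
Definition subgraph (d : Order.disp_t) (L : finTBLatticeType d)
    (dom : L -> finType) (g : rel {l : L & dom l}) (H : seq L) :
    rel {l : L & dom l} :=
  fun u v => [&& g u v, tag u \in H & tag v \in H].

Record dimension := Dimension {
  disp : Order.disp_t;
  level : finTBLatticeType disp;
  dom : level -> finType;
  dom_neq0 : forall l, (0 < #|dom l|)%N;
  all_val : dom \top%O;
  all_only : forall a : dom \top%O, a = all_val;
  dom_le : rel (dom \bot%O);
  dom_le_refl : reflexive dom_le;
  dom_le_anti : antisymmetric dom_le;
  dom_le_trans : transitive dom_le;
  dom_le_total : total dom_le;
  dgraph : rel {l : level & dom l};
  dgraph_edge : forall u v, dgraph u v -> level_edge (tag u) (tag v);
  (* a directed tree towards [all_val]: exactly one path from each node *)
  dgraph_tree : forall H, is_hierarchy H ->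
    forall u, tag u \in H ->
    exists! p, path (subgraph dgraph H) u p /\
               last u p = Tagged dom all_val;
  dgraph_sound : forall (l : level) (H1 H2 : seq level),
    is_hierarchy H1 -> l \in H1 -> is_hierarchy H2 -> l \in H2 ->
    forall (a : dom \bot%O) (b1 b2 : dom l),
    connect (subgraph dgraph H1) (Tagged dom a) (Tagged dom b1) ->
    connect (subgraph dgraph H2) (Tagged dom a) (Tagged dom b2) ->
    b1 = b2;
  dgraph_onto : forall (l : level) (b : dom l), exists a : dom \bot%O,
    connect dgraph (Tagged dom a) (Tagged dom b)
}.

Section Dimension.
Variable D : dimension.

Definition rho_in (H : seq (level D)) (l : level D)
    (a : dom (\bot%O : level D)) (b : dom l) : bool :=
  connect (subgraph (@dgraph D) H) (Tagged (@dom D) a) (Tagged (@dom D) b).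

(* Roll-up with no hierarchy mentioned. A path of the dimension graph starting
   in [dom \bot] climbs along an initial part of some hierarchy, so this says
   that a rolls up to b for some hierarchy through l; by soundness, the choice
   of that hierarchy is irrelevant. *)
Definition rho (l : level D) (a : dom (\bot%O : level D)) (b : dom l) : bool :=
  connect (@dgraph D) (Tagged (@dom D) a) (Tagged (@dom D) b).

Definition rep (l : level D) (b : dom l) : dom (\bot%O : level D) :=
  extremum (@dom_le D) (xchoose (dgraph_onto b)) (fun a => rho a b) id.

Definition dom_lt (l : level D) (b1 b2 : dom l) : bool :=
  (rep b1 != rep b2) && dom_le (rep b1) (rep b2).

(* The position, starting from 0, of b in b_1 < ... < b_s. *)
Definition dom_rank (l : level D) (b : dom l) : nat :=
  #|[pred b' : dom l | dom_lt b' b]|.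

End Dimension.

Lemma next_prime_ex (n : nat) : exists p, (n < p)%N && prime p.
Proof. by have [p lt_np p_pr] := prime_above n; exists p; rewrite lt_np. Qed.

(* [nth_prime 0 = 2], [nth_prime 1 = 3], and so on. *)
Fixpoint nth_prime (n : nat) : nat :=
  ex_minn (next_prime_ex (if n is m.+1 then nth_prime m else 0%N)).

Section Cubes.
Variables (d : nat) (dims : 'I_d -> dimension).

Definition coordinate (i : 'I_d) : finType := dom (\bot%O : level (dims i)).

Definition cell : finType := {dffun forall i : 'I_d, coordinate i}.

Definition with_coord (x : cell) (i : 'I_d) (y : coordinate i) : cell :=
  [ffun j => dfwith x y j].

Record cell_data (k l : nat) := CellData {
  protected : k.-tuple rat;
  computed : l.-tuple rat;
  flag : bool
}.

(* [None] marks an empty cell. *)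
Definition data_cube (k l : nat) := {ffun cell -> option (cell_data k l)}.

Inductive aggregate := SUM | AVG | MIN | MAX | COUNT | COUNT_DISTINCT.

(* [s] lists a multiset; it is nonempty wherever Roll-Up applies this. *)
Definition aggregate_value (f : aggregate) (s : seq rat) : rat :=
  match f with
  | SUM => \sum_(v <- s) v
  | AVG => (\sum_(v <- s) v) / (size s)%:R
  | MIN => \big[Num.min/head 0 s]_(v <- s) v
  | MAX => \big[Num.max/head 0 s]_(v <- s) v
  | COUNT => (size s)%:R
  | COUNT_DISTINCT => (size (undup s))%:R
  end.

Definition data_measure (k l : nat) (a : 'I_k + 'I_l) (c : cell_data k l) :
    rat :=
  match a with
  | inl j => tnth (protected c) j
  | inr j => tnth (computed c) j
  end.

Definition rollup_values (k l : nat) (C : data_cube k l) (i : 'I_d)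
    (H : seq (level (dims i))) (ell : level (dims i)) (a : 'I_k + 'I_l)
    (x : cell) : seq rat :=
  pmap (fun y : coordinate i => omap (data_measure a) (C (with_coord x y)))
       [seq y <- enum (coordinate i) |
          [exists b : dom ell, rho_in H (x i) b && rho_in H y b]].

Definition rollup (k l r : nat) (i : 'I_d) (H : seq (level (dims i)))
    (ell : level (dims i)) (aggs : r.-tuple (('I_k + 'I_l) * aggregate))
    (C : data_cube k l) : data_cube k r :=
  [ffun x => omap
    (fun c => CellData (protected c)
       [tuple of [seq aggregate_value af.2 (rollup_values C H ell af.1 x)
                 | af <- aggs]]
       [exists b : dom ell, x i == rep b])
    (C x)].

(* [inr j] is the j-th computed measure, input ones first, counted from 0. *)
Definition measure_ref (k : nat) := ('I_k + nat)%type.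

Inductive transformation (k : nat) :=
  | TConst of rat
  | TAdd of measure_ref k & measure_ref k
  | TMul of measure_ref k & measure_ref k
  | TDiv of measure_ref k & measure_ref k
  | TEq of measure_ref k & measure_ref k
  | TLt of measure_ref k & measure_ref k
  | TLevelEq (i : 'I_d) (l : level (dims i)) of dom l
  | TLevelLt (i : 'I_d) (l : level (dims i)) of rel (dom l) & dom l
  | TLevelGt (i : 'I_d) (l : level (dims i)) of rel (dom l) & dom l
  | TSelectConst (i : 'I_d) (l : level (dims i)) of dom l
  | TSelectLevel (i : 'I_d) of level (dims i)
  | TCountDistinct of measure_ref k
  | TSum of measure_ref k
  | TMin of measure_ref k
  | TMax of measure_ref k
  | TCountDistinctBy of nat & measure_ref k
  | TMinBy of nat & measure_ref k
  | TMaxBy of nat & measure_ref k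
  | TGroup (i : 'I_d) of level (dims i)
  | TProject of nat & nat.

(* Intermediate values live in a real closed field R, which contains the prime
   labels. They only ever involve real algebraic numbers, so that R does not
   matter. *)
Section Semantics.
Variable R : rcfType.

Definition prime_label (n : nat) : R :=
  if n is m.+1 then Num.sqrt (nth_prime m)%:R else 1.

(* Only the values in the non-empty cells are meaningful. *)
Definition measure := {ffun cell -> R}.

Record state (k : nat) := State {
  live : {set cell};
  st_protected : k.-tuple measure;
  st_computed : seq measure;
  labels_used : nat;
  (* measures made by groupings, with the dimensions they label *)
  labelings : seq ('I_d * measure)
}.

Definition lookup (k : nat) (s : state k) (a : measure_ref k) :
    option measure :=
  match a with
  | inl j => Some (tnth (st_protected s) j)
  | inr j => onth (st_computed s) j
  end.

(* Labelings made by distinct groupings use disjoint sets of labels. *)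
Definition is_labeling (k : nat) (s : state k) (t : measure) : Prop :=
  exists (I : {set 'I_d}) (lab : 'I_d -> measure),
    [/\ I != set0,
        forall i, i \in I -> (i, lab i) \in labelings s
      & {in live s, forall x, t x = \prod_(i in I) lab i x}].

Definition count_distinct (A : pred cell) (u : measure) : R :=
  (size (undup [seq u y | y in A]))%:R.

(* [creates s t f]: in state s, transformation t applies and creates f. The
   folds for min and max start at the value in the current cell x, which is one
   of the values aggregated when x is not empty. *)
Inductive creates (k : nat) (s : state k) :
    transformation k -> measure -> Prop :=
  | CreateConst c : creates s (TConst k c) [ffun _ => ratr c]
  | CreateAdd a b u v : lookup s a = Some u -> lookup s b = Some v ->
      creates s (TAdd a b) [ffun x => u x + v x]
  | CreateMul a b u v : lookup s a = Some u -> lookup s b = Some v ->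
      creates s (TMul a b) [ffun x => u x * v x]
  | CreateDiv a b u v : lookup s a = Some u -> lookup s b = Some v ->
      creates s (TDiv a b) [ffun x => if v x == 0 then u x else u x / v x]
  | CreateEq a b u v : lookup s a = Some u -> lookup s b = Some v ->
      creates s (TEq a b) [ffun x => (u x == v x)%:R]
  | CreateLt a b u v : lookup s a = Some u -> lookup s b = Some v ->
      creates s (TLt a b) [ffun x => (u x < v x)%R%:R]
  | CreateLevelEq i (l : level (dims i)) (c : dom l) :
      creates s (TLevelEq k c) [ffun x : cell => (rho (x i) c)%:R]
  | CreateLevelLt i (l : level (dims i)) (lt : rel (dom l)) (c : dom l) :
      irreflexive lt -> transitive lt ->
      creates s (TLevelLt k lt c)
        [ffun x : cell => [exists b : dom l, rho (x i) b && lt b c]%:R]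
  | CreateLevelGt i (l : level (dims i)) (lt : rel (dom l)) (c : dom l) :
      irreflexive lt -> transitive lt ->
      creates s (TLevelGt k lt c)
        [ffun x : cell => [exists b : dom l, rho (x i) b && lt c b]%:R]
  | CreateSelectConst i (l : level (dims i)) (c : dom l) :
      creates s (TSelectConst k c) [ffun x : cell => (rho (x i) c)%:R]
  | CreateSelectLevel i (l : level (dims i)) :
      creates s (TSelectLevel k l)
        [ffun x : cell => [exists b : dom l, x i == rep b]%:R]
  | CreateCountDistinct a u : lookup s a = Some u ->
      creates s (TCountDistinct a)
        [ffun _ => count_distinct [in live s] u]
  | CreateSum a u : lookup s a = Some u ->
      creates s (TSum a) [ffun _ => \sum_(y in live s) u y]
  | CreateMin a u : lookup s a = Some u ->
      creates s (TMin a) [ffun x => \big[Num.min/u x]_(y in live s) u y]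
  | CreateMax a u : lookup s a = Some u ->
      creates s (TMax a) [ffun x => \big[Num.max/u x]_(y in live s) u y]
  | CreateCountDistinctBy m a t u :
      onth (st_computed s) m = Some t -> is_labeling s t ->
      lookup s a = Some u ->
      creates s (TCountDistinctBy m a)
        [ffun x => count_distinct [pred y in live s | t y == t x] u]
  | CreateMinBy m a t u :
      onth (st_computed s) m = Some t -> is_labeling s t ->
      lookup s a = Some u ->
      creates s (TMinBy m a)
        [ffun x => \big[Num.min/u x]_(y in live s | t y == t x) u y]
  | CreateMaxBy m a t u :
      onth (st_computed s) m = Some t -> is_labeling s t ->
      lookup s a = Some u ->
      creates s (TMaxBy m a)
        [ffun x => \big[Num.max/u x]_(y in live s | t y == t x) u y]
  (* exactly one b satisfies rho (x i) b, so the default 0 is never taken *)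
  | CreateGroup i (l : level (dims i)) :
      creates s (TGroup k l)
        [ffun x : cell => (if [pick b : dom l | rho (x i) b] is Some b
           then prime_label (labels_used s + dom_rank b)%N else 0) : R]
  (* u is the prime sum of a rational measure q; the coefficient of the label w
     is the sum of q over the cells labelled w *)
  | CreateProject m n u t (q : cell -> rat) :
      onth (st_computed s) m = Some u ->
      onth (st_computed s) n = Some t -> is_labeling s t ->
      {in live s, forall x, u x = \sum_(y in live s) ratr (q y) * t y} ->
      creates s (TProject k m n)
        [ffun x => \sum_(y in live s | t y == t x) ratr (q y)].

Definition extend (k : nat) (s : state k) (t : transformation k)
    (f : measure) : state k :=
  let computed' := rcons (st_computed s) f in
  match t with
  | TGroup i l =>
      State (live s) (st_protected s) computed'
        (labels_used s + #|dom l|)%N ((i, f) :: labelings s)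
  | _ =>
      State (live s) (st_protected s) computed'
        (labels_used s) (labelings s)
  end.

Inductive runs (k : nat) : state k -> seq (transformation k) -> state k ->
    Prop :=
  | RunNil s : runs s [::] s
  | RunCons s t f ts s' :
      creates s t f -> runs (extend s t f) ts s' -> runs s (t :: ts) s'.

Definition initial_state (k l : nat) (C : data_cube k l) : state k :=
  let value (get : cell_data k l -> rat) : measure :=
    [ffun x => if C x is Some c then ratr (get c) else 0] in
  State [set x | isSome (C x)]
    [tuple value (fun c => tnth (protected c) j) | j < k]
    [seq value (fun c => tnth (computed c) j) | j <- enum 'I_l]
    0%N [::].

Inductive boolean_source (k : nat) :=
  | NewMeasure of transformation k
  | OldMeasure of measure_ref k.

Definition boolean_result (k : nat) (s : state k) (b : boolean_source k)
    (f : measure) : Prop :=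
  match b with
  | NewMeasure t => creates s t f
  | OldMeasure a => lookup s a = Some f
  end /\ {in live s, forall x, f x = 0 \/ f x = 1}.

Record olap_operation (k : nat) := OlapOperation {
  op_body : seq (transformation k);
  op_destructor : option (boolean_source k);
  op_flag : boolean_source k
}.

Definition destructor_result (k : nat) (s : state k)
    (b : option (boolean_source k)) (f : measure) : Prop :=
  if b is Some b' then boolean_result s b' f else f = [ffun _ => 1].

(* m is the arity; C' keeps the last m computed measures, which must therefore
   have rational values. *)
Definition olap_output (k l m : nat) (op : olap_operation k)
    (C : data_cube k l) (C' : data_cube k m) : Prop :=
  exists (s : state k) (delta phi : measure),
    [/\ runs (initial_state C) (op_body op) s,
        (m <= size (st_computed s))%N,
        destructor_result s (op_destructor op) delta,
        boolean_result s (op_flag op) phi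
      & forall x, match C x with
        | None => C' x = None
        | Some c =>
            if delta x == 0 then C' x = None else
            exists2 c', C' x = Some c' &
              [/\ protected c' = protected c,
                  forall j : 'I_m, ratr (tnth (computed c') j) =
                    nth [ffun _ => 0] (st_computed s)
                      (size (st_computed s) - m + j)%N x
                & (flag c')%:R = phi x]
        end].

(* One operation serves all cubes with the given dimensions and numbers of
   measures. The equivalence says that it does have an output on each of them,
   and no other output than that of F. *)
Definition olap_expressible (k l m : nat)
    (F : data_cube k l -> data_cube k m) : Prop :=
  exists op : olap_operation k,
    forall (C : data_cube k l) (C' : data_cube k m),
      olap_output op C C' <-> C' = F C.

End Semantics.

End Cubes.

(* Main.v *)
Require Import Defs.
From mathcomp Require Import all_boot all_order all_algebra.

Set Implicit Arguments.
Unset Strict Implicit.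
Unset Printing Implicit Defensive.

Import Order.TTheory GRing.Theory Num.Theory.
Local Open Scope ring_scope.

(** The operation may depend on the dimensions, so prime labels are not needed.
    The tests against elements of Bottom, multiplied over all dimensions, give
    the indicator of a single cell z; summing the product of this indicator and
    F_z over all z creates the measure whose value in each cell z is that of
    F_z there. In particular a measure can be altered outside any fixed set of
    cells. An aggregate over the group of z is then a global aggregate of the
    measure altered outside the group: to 0 for sums and counts, to its global
    maximum for MIN, to its global minimum for MAX, and to the minimum of the
    group for COUNT-DISTINCT. As no prime sum is projected, every transformation
    creates exactly one measure, so that the output is unique. *)

(** * Tests at Bottom, and folds that select an entry *)

(** Every edge goes strictly up in the lattice, so no non-empty path ends in Bottom. The test
    against an element of Bottom is therefore a test of a single coordinate. *)
Lemma rho_bottom (D : dimension) (a c : dom (\bot%O : level D)) :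
  rho a c = (a == c).
Proof.
apply/idP/eqP => [/connectP[p]|->]; last exact: connect0.
case/lastP: p => [_ /eqP | p v].
  by rewrite eq_Tagged => /eqP.
rewrite rcons_path last_rcons => /andP[_ /dgraph_edge] /[swap] <- /andP[].
by rewrite ltx0.
Qed.

(** The fold starts at an entry of the list, and [op] always returns one of its arguments. This
    makes the MIN or MAX of a group a value attained in the group. *)
Lemma big_head_mem (op : rat -> rat -> rat) (s : seq rat) :
  (forall p q, op p q = p \/ op p q = q) -> s != [::] ->
  \big[op/head 0 s]_(v <- s) v \in s.
Proof.
move=> op_sel; have mem_big x : \big[op/x]_(v <- s) v \in x :: s.
  elim: s => [|v s IH]; first by rewrite big_nil mem_head.
  rewrite big_cons; case: (op_sel v (\big[op/x]_(u <- s) u)) => ->.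
    by rewrite !inE eqxx orbT.
  by move: IH; rewrite !inE => /orP[->|->] //; rewrite !orbT.
case: s mem_big => // v s /(_ v) + _; rewrite !inE /=.
by case/orP=> [->|].
Qed.

(** * Label-free programs and their unique runs *)

Section Programs.
Variables (d : nat) (dims : 'I_d -> dimension) (R : rcfType) (k l : nat).
Implicit Types (C : data_cube dims k l) (ds ws : seq (measure dims R)).
Implicit Types (s : state dims R k) (t : transformation dims k).
Implicit Types (ts : seq (transformation dims k)) (a b : measure_ref k).
Implicit Types (F G : data_cube dims k l -> cell dims -> R).

(** Inversion of [creates], phrased as a function of the transformation so that the level tests
    leave no equalities between dependent pairs. Only the transformations that occur in the programs
    below are covered. *)
Definition created_value s t (f : measure dims R) : Prop :=
  match t with
  | TConst c => f = [ffun _ => ratr c]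
  | TAdd a b => forall u v, lookup s a = Some u -> lookup s b = Some v ->
      f = [ffun x => u x + v x]
  | TMul a b => forall u v, lookup s a = Some u -> lookup s b = Some v ->
      f = [ffun x => u x * v x]
  | TDiv a b => forall u v, lookup s a = Some u -> lookup s b = Some v ->
      f = [ffun x => if v x == 0 then u x else u x / v x]
  | TLevelEq i _ c => f = [ffun x : cell dims => (rho (x i) c)%:R]
  | TSelectLevel i lv =>
      f = [ffun x : cell dims => [exists b : dom lv, x i == rep b]%:R]
  | TSum a => forall u, lookup s a = Some u ->
      f = [ffun _ => \sum_(y in live s) u y]
  | TMin a => forall u, lookup s a = Some u ->
      f = [ffun x => \big[Num.min/u x]_(y in live s) u y]
  | TMax a => forall u, lookup s a = Some u ->
      f = [ffun x => \big[Num.max/u x]_(y in live s) u y]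
  | TCountDistinct a => forall u, lookup s a = Some u ->
      f = [ffun _ => count_distinct [in live s] u]
  | _ => True
  end.

Lemma creates_value s t f : creates s t f -> created_value s t f.
Proof.
case=> //=.
- by move=> a b u v -> -> u' v' [<-] [<-].
- by move=> a b u v -> -> u' v' [<-] [<-].
- by move=> a b u v -> -> u' v' [<-] [<-].
- by move=> a u -> u' [<-].
- by move=> a u -> u' [<-].
- by move=> a u -> u' [<-].
- by move=> a u -> u' [<-].
Qed.

(** The state after creating [ds] without any grouping: no label has been assigned. *)
Definition cube_state C ds : state dims R k :=
  let s0 := initial_state R C in
  State (live s0) (st_protected s0) (st_computed s0 ++ ds) 0%N [::].

Lemma lookup_cat C ds ws a u :
  lookup (cube_state C ds) a = Some u ->
  lookup (cube_state C (ds ++ ws)) a = Some u.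
Proof.
case: a => //= n nu; rewrite catA onth_cat; case: ltnP => // le_n.
by rewrite onth_default in nu.
Qed.

Lemma lookup_last C ds ws w n : (size ds + size ws)%N = n ->
  lookup (cube_state C (ds ++ rcons ws w)) (inr (l + n)%N) = Some w.
Proof.
move=> <- /=; rewrite -rcons_cat -rcons_cat -cats1 onth_cat.
by rewrite !size_cat size_map size_enum_ord ltnn subnn.
Qed.

Lemma runs_cons s t ts s' :
  runs s (t :: ts) s' <->
  exists2 f, creates s t f & runs (extend s t f) ts s'.
Proof.
split=> [run|[f sf run]]; last exact: RunCons sf run.
by inversion run as [|? ? f ? ? sf run']; exists f.
Qed.

Lemma runs_nil s s' : runs s [::] s' <-> s' = s.
Proof. by split=> [run|->]; [inversion run | exact: RunNil]. Qed.

Lemma runs_cat s ts ts' s' :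
  runs s (ts ++ ts') s' <-> exists2 s1, runs s ts s1 & runs s1 ts' s'.
Proof.
elim: ts s => [|t ts IH] s /=.
  by split=> [run|[s1 /runs_nil->]] //; exists s => //; exact: RunNil.
split=> [/runs_cons[f sf /IH[s1 run1 run2]]|[s1 /runs_cons[f sf run1] run2]].
  by exists s1 => //; apply/runs_cons; exists f.
by apply/runs_cons; exists f => //; apply/IH; exists s1.
Qed.

(** The equivalence records both that a run exists and that its final state is unique; the
    uniqueness of the output cube rests on the latter. *)
Definition yields C ds ts ws : Prop :=
  size ws = size ts /\
  forall s, runs (cube_state C ds) ts s <-> s = cube_state C (ds ++ ws).

Lemma yields_nil C ds : yields C ds [::] [::].
Proof. by split=> // s; rewrite cats0; exact: runs_nil. Qed.

Lemma yields_cat C ds ts ws ts' ws' :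
  yields C ds ts ws -> yields C (ds ++ ws) ts' ws' ->
  yields C ds (ts ++ ts') (ws ++ ws').
Proof.
move=> [sz run] [sz' run']; split=> [|s]; first by rewrite !size_cat sz sz'.
rewrite catA; split=> [/runs_cat[s1 /run->] /run'|/run' run1] //.
by apply/runs_cat; exists (cube_state C (ds ++ ws)) => //; apply/run.
Qed.

Definition unlabelled t := if t is TGroup _ _ then false else true.

Lemma extend_cube_state C ds t f : unlabelled t ->
  extend (cube_state C ds) t f = cube_state C (rcons ds f).
Proof. by rewrite /cube_state -rcons_cat; case: t. Qed.

Lemma yields1 C ds t w : unlabelled t ->
  (forall f, creates (cube_state C ds) t f <-> f = w) ->
  yields C ds [:: t] [:: w].
Proof.
move=> t_unl tw; split=> // s; rewrite cats1; split.
  by case/runs_cons=> f /tw-> /runs_nil; rewrite extend_cube_state.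
move=> ->; apply/runs_cons; exists w; first exact/tw.
by rewrite extend_cube_state //; exact: RunNil.
Qed.

Lemma yields_map (I : Type) (r : seq I) (t : I -> transformation dims k)
    (w : I -> measure dims R) C ds :
  (forall i, unlabelled (t i)) ->
  (forall i ws f, creates (cube_state C (ds ++ ws)) (t i) f <-> f = w i) ->
  yields C ds (map t r) (map w r).
Proof.
(* The prefix grows with each transformation, so it is generalized before the induction. *)
move=> t_unl tw; suff H ws : yields C (ds ++ ws) (map t r) (map w r).
  by have := H [::]; rewrite cats0.
elim: r ws => [|i r IH] ws; first exact: yields_nil.
rewrite /= -cat1s -[w i :: _]cat1s.
by apply: yields_cat; [exact: yields1 | rewrite -catA].
Qed.

(* The program must work after any n measures added to the input ones, so that
   programs can be chained; the values of F outside the non-empty cells are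
   irrelevant. *)
Definition definable F : Prop := forall n, exists ts a, forall C ds,
  size ds = n -> exists ws, yields C ds ts ws /\
  exists2 w, lookup (cube_state C (ds ++ ws)) a = Some w
           & forall x, C x -> w x = F C x.

(** * Closure of definable functions under the atomic transformations *)

Lemma definable_ext F G :
  (forall C x, C x -> F C x = G C x) -> definable F -> definable G.
Proof.
move=> FG dF n; have [ts [a H]] := dF n; exists ts, a => C ds sz.
have [ws [ytw [w aw wF]]] := H C ds sz; exists ws; split=> //.
by exists w => // x Cx; rewrite wF ?FG.
Qed.

Definition input_value (a : 'I_k + 'I_l) C (x : cell dims) : R :=
  if C x is Some c then ratr (data_measure a c) else 0.

Lemma definable_input (a : 'I_k + 'I_l) : definable (input_value a).
Proof.
move=> n; exists [::].
exists (match a with inl j => inl j | inr j => inr (j : nat) end).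
move=> C ds _; exists [::]; split; first exact: yields_nil.
exists [ffun x => input_value a C x];
  last by move=> x _; rewrite ffunE.
case: a => j /=; first by rewrite tnth_mktuple.
by rewrite onth_cat size_map size_enum_ord ltn_ord onth_map
  (_ : onth _ _ = Some j) // (onthE (enum _)) (nth_map j) ?size_enum_ord
  ?nth_ord_enum.
Qed.

Lemma definable0 t (w : measure dims R) : unlabelled t ->
  (forall s f, creates s t f <-> f = w) -> definable (fun _ x => w x).
Proof.
move=> t_unl tw n; exists [:: t], (inr (l + n)%N) => C ds sz; exists [:: w].
split; first exact: yields1.
by exists w => //; apply: (lookup_last _ (ws := [::])); rewrite addn0.
Qed.

(** Here [op] sees the set of non-empty cells and the whole measure, which covers global aggregates.
    The third hypothesis makes the arbitrary values of a measure in empty cells harmless. *)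
Lemma definable1 (t : measure_ref k -> transformation dims k)
    (op : {set cell dims} -> measure dims R -> cell dims -> R) F G :
  (forall a, unlabelled (t a)) ->
  (forall s a u f, lookup s a = Some u ->
     creates s (t a) f <-> f = [ffun x => op (live s) u x]) ->
  (forall C (u : measure dims R), (forall x, C x -> u x = F C x) ->
     forall x, C x -> op [set y | isSome (C y)] u x = G C x) ->
  definable F -> definable G.
Proof.
move=> t_unl top opFG dF n; have [ts [a H]] := dF n.
exists (rcons ts (t a)), (inr (l + (n + size ts)))%N => C ds sz.
have [ws [ytw [w aw wF]]] := H C ds sz.
set w' := [ffun x => op [set y | isSome (C y)] w x].
exists (rcons ws w'); split.
  rewrite -!cats1; apply: yields_cat ytw _; apply: yields1 => // f.
  exact: top aw.
exists w'; first by apply: lookup_last; rewrite sz ytw.1.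
by move=> x Cx; rewrite ffunE (opFG _ _ wF).
Qed.

(** The second program runs after the measures of the first one. The reference to the first operand
    stays valid because measures are only appended. *)
Lemma definable2 (t : measure_ref k -> measure_ref k -> transformation dims k)
    (op : R -> R -> R) F G :
  (forall a b, unlabelled (t a b)) ->
  (forall s a b u v f, lookup s a = Some u -> lookup s b = Some v ->
     creates s (t a b) f <-> f = [ffun x => op (u x) (v x)]) ->
  definable F -> definable G -> definable (fun C x => op (F C x) (G C x)).
Proof.
move=> t_unl top dF dG n; have [ts [a H]] := dF n.
have [ts' [b H']] := dG (n + size ts)%N.
exists (rcons (ts ++ ts') (t a b)), (inr (l + (n + size (ts ++ ts'))))%N.
move=> C ds sz; have [ws [ytw [w aw wF]]] := H C ds sz.
have [|ws' [ytw' [w' bw' wG]]] := H' C (ds ++ ws).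
  by rewrite size_cat sz ytw.1.
set v := [ffun x => op (w x) (w' x)]; exists (rcons (ws ++ ws') v); split.
  rewrite -!cats1; apply: yields_cat (yields_cat ytw ytw') _.
  apply: yields1 => // f; rewrite catA.
  exact: top (lookup_cat _ aw) bw'.
exists v; last by move=> x Cx; rewrite ffunE wF ?wG.
by apply: lookup_last; rewrite sz !size_cat ytw.1 ytw'.1.
Qed.

Lemma definable_const (c : rat) : definable (fun _ _ => ratr c).
Proof.
apply: (definable_ext (F := fun _ x => [ffun _ => ratr c] x)).
  by move=> C x _; rewrite ffunE.
apply: (@definable0 (TConst dims k c)) => // s f.
by split=> [/creates_value | ->] //; exact: CreateConst.
Qed.

Lemma definable_coord i (c : coordinate dims i) :
  definable (fun _ x => (x i == c)%:R).
Proof.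
apply: (definable_ext
  (F := fun _ x => [ffun x : cell dims => (rho (x i) c)%:R] x)).
  by move=> C x _; rewrite ffunE rho_bottom.
apply: (@definable0 (TLevelEq k c)) => // s f.
by split=> [/creates_value | ->] //; exact: CreateLevelEq.
Qed.

Lemma definable_add F G :
  definable F -> definable G -> definable (fun C x => F C x + G C x).
Proof.
apply: (@definable2 (@TAdd _ dims k) +%R) => // s a b u v f au bv.
by split=> [/creates_value | ->]; [exact | exact: CreateAdd].
Qed.

Lemma definable_mul F G :
  definable F -> definable G -> definable (fun C x => F C x * G C x).
Proof.
apply: (@definable2 (@TMul _ dims k) *%R) => // s a b u v f au bv.
by split=> [/creates_value | ->]; [exact | exact: CreateMul].
Qed.

Lemma definable_div F G :
  definable F -> definable G ->
  definable (fun C x => if G C x == 0 then F C x else F C x / G C x).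
Proof.
apply: (@definable2 (@TDiv _ dims k)
  (fun p q => if q == 0 then p else p / q)) => // s a b u v f au bv.
by split=> [/creates_value | ->]; [exact | exact: CreateDiv].
Qed.

Lemma definable_sum F : definable F ->
  definable (fun C _ => \sum_(y | C y) F C y).
Proof.
apply: (@definable1 (@TSum _ dims k) (fun A u _ => \sum_(y in A) u y)) => //.
  move=> s a u f au; split=> [/creates_value | ->]; [exact | exact: CreateSum].
by move=> C u uF x _; apply: eq_big => y; rewrite inE //; apply: uF.
Qed.

Lemma definable_min F : definable F ->
  definable (fun C x => \big[Num.min/F C x]_(y | C y) F C y).
Proof.
apply: (@definable1 (@TMin _ dims k)
  (fun A u x => \big[Num.min/u x]_(y in A) u y)) => //.
  move=> s a u f au; split=> [/creates_value | ->]; [exact | exact: CreateMin].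
move=> C u uF x Cx; rewrite uF //.
by apply: eq_big => y; rewrite inE //; apply: uF.
Qed.

Lemma definable_max F : definable F ->
  definable (fun C x => \big[Num.max/F C x]_(y | C y) F C y).
Proof.
apply: (@definable1 (@TMax _ dims k)
  (fun A u x => \big[Num.max/u x]_(y in A) u y)) => //.
  move=> s a u f au; split=> [/creates_value | ->]; [exact | exact: CreateMax].
move=> C u uF x Cx; rewrite uF //.
by apply: eq_big => y; rewrite inE //; apply: uF.
Qed.

Lemma definable_count_distinct F : definable F ->
  definable (fun C _ => (size (undup [seq F C y | y in [pred y | C y]]))%:R).
Proof.
apply: (@definable1 (@TCountDistinct _ dims k)
  (fun A u _ => count_distinct [in A] u)) => //.
  move=> s a u f au; split=> [/creates_value | ->]; [exact|].
  exact: CreateCountDistinct.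
move=> C u uF x _; rewrite /count_distinct; congr (size (undup _))%:R.
rewrite /image_mem (eq_enum (B := [pred y | C y])); last
  by move=> y; rewrite !inE.
by apply/eq_in_map => y; rewrite mem_enum; apply: uF.
Qed.

(** * Choosing a different function in each cell *)

Lemma definable_by_cell
    (F : cell dims -> data_cube dims k l -> cell dims -> R) :
  (forall z, definable (F z)) -> definable (fun C x => F x C x).
Proof.
move=> dF.
(* The list of dimensions is a parameter so that the indicator can be built by induction, one
   coordinate test at a time. *)
pose is_cell (js : seq 'I_d) (z x : cell dims) : R :=
  \prod_(j <- js) (x j == z j)%:R.
have d_cell js z : definable (fun _ => is_cell js z).
  elim: js => [|j js IH].
    apply: definable_ext (definable_const 1) => C x _.
    by rewrite /is_cell big_nil rmorph1.
  apply: definable_ext (definable_mul (definable_coord (z j)) IH) => C x _.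
  by rewrite /is_cell big_cons.
have d_sum zs : definable
    (fun C x => \sum_(z <- zs) is_cell (index_enum 'I_d) z x * F z C x).
  elim: zs => [|z zs IH].
    apply: definable_ext (definable_const 0) => C x _.
    by rewrite big_nil rmorph0.
  apply: definable_ext (definable_add (definable_mul (d_cell _ z) (dF z)) IH).
  by move=> C x _; rewrite big_cons.
apply: definable_ext (d_sum (index_enum _)) => C x _.
(* In cell x the term of x has indicator 1; any other z differs from x in some coordinate, whose
   factor is 0. *)
rewrite (bigD1 x) //= [is_cell _ _ _]big1 ?mul1r => [|j _]; last
  by rewrite eqxx.
rewrite big1 ?addr0 // => z /eqP neq_zx.
suff [j neq_j] : exists j, x j != z j.
  by rewrite /is_cell (bigD1 j) //= (negPf neq_j) !mul0r.
apply/existsP; rewrite -negb_forall; apply/forallP => eq_xz; apply: neq_zx.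
by apply/ffunP => j; apply/eqP; rewrite eq_sym.
Qed.

Lemma definable_if (P : pred (cell dims)) F G :
  definable F -> definable G ->
  definable (fun C x => if P x then F C x else G C x).
Proof.
move=> dF dG.
apply: (@definable_by_cell (fun z C x => if P z then F C x else G C x)) => z.
by case: (P z).
Qed.

(** * Aggregates over groups as global aggregates *)

Section Aggregates.
Variables (S : rel (cell dims)) (F : data_cube dims k l -> cell dims -> R).
Variable V : data_cube dims k l -> cell dims -> seq rat.
Hypothesis dF : definable F.
(* S x is the group of x; a cell outside its own group has an empty one, on
   which every aggregate takes the default value 0. *)
Hypothesis S_refl_or_empty : forall x, ~~ S x x -> S x =1 pred0.
Hypothesis perm_V : forall C x,
  perm_eq (map ratr (V C x)) [seq F C y | y in [pred y | S x y && C y]].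

Let mem_V C x y : S x y -> C y -> exists2 v, v \in V C x & F C y = ratr v.
Proof.
move=> Sxy Cy; suff /mapP[v] : F C y \in map ratr (V C x) by exists v.
by rewrite (perm_mem (perm_V C x)); apply: image_f; rewrite inE Sxy.
Qed.

Let V_mem C x v : v \in V C x -> exists y, [/\ S x y, C y & F C y = ratr v].
Proof.
move=> /(map_f (ratr : rat -> R)); rewrite (perm_mem (perm_V C x)).
by case/imageP => y /andP[Sxy Cy] ->; exists y.
Qed.

Let sum_V C x : ratr (\sum_(v <- V C x) v) =
  \sum_(y | C y) (if S x y then F C y else 0).
Proof.
rewrite rmorph_sum -(big_map ratr xpredT id) (perm_big _ (perm_V C x)).
rewrite big_map big_enum -big_mkcondr.
by apply: eq_bigl => y; rewrite inE andbC.
Qed.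

Let size_V C x : (size (V C x))%:R =
  \sum_(y | C y) (if S x y then 1 else 0) :> R.
Proof.
rewrite -(size_map (ratr : rat -> R)) (perm_size (perm_V C x)) size_map -cardE.
rewrite -big_mkcondr sumr_const; congr _%:R.
by apply: eq_card => y; rewrite !inE andbC.
Qed.

(** In a non-empty cell the starting value of each fold is itself one of the terms, so these are the
    same extrema in all such cells. *)
Let low C x := \big[Num.min/F C x]_(y | C y) F C y.
Let high C x := \big[Num.max/F C x]_(y | C y) F C y.
Let min_in z C x :=
  let f y := if S z y then F C y else high C y in
  \big[Num.min/f x]_(y | C y) f y.
Let max_in z C x :=
  let f y := if S z y then F C y else low C y in
  \big[Num.max/f x]_(y | C y) f y.

Let min_inE z C x : S z z -> C z -> C x ->
  min_in z C x = ratr (aggregate_value MIN (V C z)).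
Proof.
move=> Szz Cz Cx; set m := aggregate_value _ _.
(* The minimum of the group is attained at some [y0]. This cell bounds the global minimum from
   above, and also shows that the filler [high] is at least m. *)
have [y0 [Szy0 Cy0 y0m]] : exists y, [/\ S z y, C y & F C y = ratr m].
  apply: V_mem; apply: big_head_mem => [p q|].
    by rewrite minEle; case: ifP; [left | right].
  by have [v + _] := mem_V Szz Cz; case: (V C z).
apply/le_anti/andP; split.
  by apply: (bigmin_inf y0) => //; rewrite Szy0 y0m.
suff le_m y : C y -> ratr m <= if S z y then F C y else high C y.
  by apply/bigmin_geP; split; [exact: le_m | move=> y; exact: le_m].
move=> Cy; case: ifP => Szy; last by rewrite -y0m; exact: (bigmax_sup y0).
by have [v vV ->] := mem_V Szy Cy; rewrite ler_rat; exact: ge_bigmin_seq.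
Qed.

Let max_inE z C x : S z z -> C z -> C x ->
  max_in z C x = ratr (aggregate_value MAX (V C z)).
Proof.
move=> Szz Cz Cx; set m := aggregate_value _ _.
(* Dually, the cell [y0] attaining the maximum shows that the filler [low] is at most m. *)
have [y0 [Szy0 Cy0 y0m]] : exists y, [/\ S z y, C y & F C y = ratr m].
  apply: V_mem; apply: big_head_mem => [p q|].
    by rewrite maxEle; case: ifP; [right | left].
  by have [v + _] := mem_V Szz Cz; case: (V C z).
apply/le_anti/andP; split; last first.
  by apply: (bigmax_sup y0) => //; rewrite Szy0 y0m.
suff ge_m y : C y -> (if S z y then F C y else low C y) <= ratr m.
  by apply/bigmax_leP; split; [exact: ge_m | move=> y; exact: ge_m].
move=> Cy; case: ifP => Szy; last by rewrite -y0m; exact: (bigmin_inf y0).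
by have [v vV ->] := mem_V Szy Cy; rewrite ler_rat; exact: le_bigmax_seq.
Qed.

Let count_inE z C : S z z -> C z ->
  (size (undup [seq if S z y then F C y else min_in z C y
               | y in [pred y | C y]]))%:R
    = ratr (aggregate_value COUNT_DISTINCT (V C z)) :> R.
Proof.
move=> Szz Cz; rewrite /aggregate_value ratr_nat; congr _%:R.
rewrite -(size_map (ratr : rat -> R) (undup _)) -undup_map_inj; last
  exact: fmorph_inj.
apply/perm_size/perm_undup => w; apply/imageP/mapP => [[y Cy ->]|[v vV ->]].
  case: ifP => [Szy|_]; first by have [v] := mem_V Szy Cy; exists v.
  (* The filler outside the group is one of the group's own values, so it adds no distinct value. *)
  rewrite min_inE //; exists (aggregate_value MIN (V C z)) => //.
  apply: big_head_mem => [p q|].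
    by rewrite minEle; case: ifP; [left | right].
  by have [v + _] := mem_V Szz Cz; case: (V C z).
by have [y [Szy Cy <-]] := V_mem vV; exists y => //; rewrite Szy.
Qed.

Lemma definable_aggregate f :
  definable (fun C x => ratr (aggregate_value f (V C x))).
Proof.
have d_sum z G (dG : definable G) :
    definable (fun C _ => \sum_(y | C y) (if S z y then G C y else 0)).
  apply/definable_sum/definable_if => //.
  by apply: definable_ext (definable_const 0) => C x _; rewrite rmorph0.
have d1 : definable (fun _ _ => 1).
  by apply: definable_ext (definable_const 1) => C x _; rewrite rmorph1.
have d_low : definable low := definable_min dF.
have d_high : definable high := definable_max dF.
have d_min z : definable (min_in z) by exact/definable_min/definable_if.
have d_max z : definable (max_in z) by exact/definable_max/definable_if.
(* The group varies with the cell, so a program is built for each fixed z and its value kept only at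
   z. Cells outside their own group receive 0. *)
have by_group (E : cell dims -> data_cube dims k l -> cell dims -> R) :
    (forall z, definable (E z)) ->
    (forall C x, S x x -> C x -> E x C x = ratr (aggregate_value f (V C x))) ->
    definable (fun C x => ratr (aggregate_value f (V C x))).
  move=> dE EV; pose E0 z := if S z z then E z else fun _ _ => 0.
  apply: (@definable_ext (fun C x => E0 x C x)); last first.
    apply: definable_by_cell => z; rewrite /E0; case: ifP => // _.
    by apply: definable_ext (definable_const 0) => C x _; rewrite rmorph0.
  move=> C x Cx; rewrite /E0; case: ifPn => [Sxx|nSxx]; first exact: EV.
  have -> : V C x = [::].
    case def_V: (V C x) => [//|v s].
    have [|y []] := @V_mem C x v; first by rewrite def_V mem_head.
    by rewrite S_refl_or_empty.
  by case: (f); rewrite /= ?big_nil ?mul0r ?rmorph0.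
case: f by_group => by_group.
- by apply: (by_group _ (fun z => d_sum z _ dF)) => C x _ _; rewrite -sum_V.
- apply: (by_group _ (fun z => definable_div (d_sum z _ dF) (d_sum z _ d1))).
  move=> C x _ _; rewrite -size_V -sum_V /= fmorph_div rmorph_nat.
  (* The convention for division by zero does no harm: a zero count means an empty list, whose sum
     and average are both 0. *)
  case: eqP => //; move=> /eqP; rewrite pnatr_eq0 => /nilP ->.
  by rewrite big_nil !rmorph0 mul0r.
- by apply: (by_group _ d_min) => C x Sxx Cx; exact: min_inE.
- by apply: (by_group _ d_max) => C x Sxx Cx; exact: max_inE.
- apply: (by_group _ (fun z => d_sum z _ d1)) => C x _ _.
  by rewrite -size_V /= ratr_nat.
- apply: (by_group _ (fun z =>
    definable_count_distinct (definable_if (S z) dF (d_min z)))).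
  by move=> C x Sxx Cx; exact: count_inE.
Qed.

End Aggregates.

(** The programs are run one after the other, giving a single program with one reference per index;
    earlier references survive the later runs. *)
Lemma definable_family (I : finType)
    (F : I -> data_cube dims k l -> cell dims -> R) :
  (forall i, definable (F i)) ->
  forall n, exists ts (a : I -> measure_ref k), forall C ds, size ds = n ->
  exists ws, yields C ds ts ws /\
  forall i, exists2 w, lookup (cube_state C (ds ++ ws)) (a i) = Some w
                     & forall x, C x -> w x = F i C x.
Proof.
move=> dF n.
suff H (r : seq I) : exists ts (a : I -> measure_ref k), forall C ds,
    size ds = n -> exists ws, yields C ds ts ws /\
    forall i, i \in r ->
    exists2 w, lookup (cube_state C (ds ++ ws)) (a i) = Some w
             & forall x, C x -> w x = F i C x.
  have [ts [a H']] := H (enum I); exists ts, a => C ds sz.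
  have [ws [ytw H'']] := H' C ds sz; exists ws; split=> // i.
  by apply: H''; rewrite mem_enum.
elim: r => [|i0 r [ts [a H]]].
  exists [::], (fun _ => inr 0%N) => C ds _; exists [::].
  by split; first exact: yields_nil.
have [ts' [b H']] := dF i0 (n + size ts)%N.
exists (ts ++ ts'), (fun i => if i == i0 then b else a i) => C ds sz.
have [ws [ytw aF]] := H C ds sz.
have [|ws' [ytw' [w bw wF]]] := H' C (ds ++ ws).
  by rewrite size_cat sz ytw.1.
exists (ws ++ ws'); split=> [|i]; first exact: yields_cat.
rewrite inE catA; case: eqP => [-> _|_ /aF[u au uF]]; first by exists w.
by exists u; first exact: lookup_cat.
Qed.

End Programs.

(** * Roll-Up groups and the final operation *)

(** The second conjunct says that y agrees with x in every dimension other than i. *)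
Definition rollup_group (d : nat) (dims : 'I_d -> dimension) (i : 'I_d)
    (H : seq (level (dims i))) (ell : level (dims i)) : rel (cell dims) :=
  fun x y => [exists b : dom ell, rho_in H (x i) b && rho_in H (y i) b] &&
             (y == with_coord x (y i)).

Lemma perm_rollup_values (R : rcfType) (d : nat) (dims : 'I_d -> dimension)
    (k l : nat) (C : data_cube dims k l) (i : 'I_d)
    (H : seq (level (dims i))) (ell : level (dims i)) (a : 'I_k + 'I_l)
    (x : cell dims) :
  perm_eq (map ratr (rollup_values C H ell a x))
          [seq input_value R a C y
          | y in [pred y | rollup_group H ell x y && C y]].
Proof.
rewrite /rollup_values; set L := filter _ _.
(* Empty cells are dropped before their values are read, which turns both sides into images of lists
   of cells. These lists are duplicate-free, so comparing their members suffices. *)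
have ->: map ratr (pmap (fun y : coordinate dims i =>
    omap (data_measure a) (C (with_coord x y))) L)
    = map (input_value R a C) [seq y <- map (@with_coord _ _ x i) L | C y].
  elim: L => //= y L IH; rewrite /input_value.
  by case Cy: (C (with_coord x y)) => [c|] //=; rewrite Cy IH.
have with_coordK (y : coordinate dims i) : with_coord x y i = y.
  by rewrite ffunE dfwith_in.
apply/perm_map/uniq_perm; last move=> y.
- apply: filter_uniq; rewrite map_inj_uniq; first exact/filter_uniq/enum_uniq.
  by move=> y z /(congr1 (fun w : cell dims => w i)); rewrite !with_coordK.
- exact: enum_uniq.
rewrite mem_filter mem_enum inE andbC; congr andb.
apply/mapP/andP => [[z + ->]|[xy /eqP y_eq]].
  by rewrite mem_filter with_coordK => /andP[].
by exists (y i) => //; rewrite mem_filter xy mem_enum.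
Qed.

Theorem mainTheorem5 (R : rcfType) (d : nat) (hd : (0 < d)%N)
    (dims : 'I_d -> dimension) (k l : nat)
    (i : 'I_d) (H : seq (level (dims i))) (ell : level (dims i))
    (hH : is_hierarchy H) (hell : ell \in H)
    (r : nat) (aggs : r.-tuple (('I_k + 'I_l) * aggregate)) :
  olap_expressible R (@rollup d dims k l r i H ell aggs).
Proof.
pose F (j : 'I_r) (C : data_cube dims k l) (x : cell dims) : R :=
  ratr (aggregate_value (tnth aggs j).2
          (rollup_values C H ell (tnth aggs j).1 x)).
have dF j : definable (F j).
  refine (definable_aggregate (S := rollup_group H ell)
    (V := fun C => rollup_values C H ell (tnth aggs j).1)
    (definable_input dims R (tnth aggs j).1) _ _ (tnth aggs j).2).
    (* Since x always agrees with itself outside dimension i, it can only miss its own group if its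
       coordinate rolls up to no b, and then the group is empty. *)
    move=> x; rewrite negb_and => /orP[/existsPn nb y|/eqP[]]; last first.
      apply/ffunP=> j'; rewrite ffunE.
      by have [<-|ne_ij] := eqVneq i j'; rewrite ?dfwith_in ?dfwith_out.
    apply/negbTE/nandP; left; apply/existsPn => b.
    by have := nb b; rewrite andbb => /negbTE->.
  by move=> C x; exact: perm_rollup_values.
have [ts [a progF]] := definable_family dF 0%N.
(* The results may lie anywhere among the measures, whereas the output keeps the last r computed
   ones. Adding the constant 0 to each result copies it to the end, in the right order. *)
have [ts0 [z prog0]] := @definable_const d dims R k l 0 (size ts).
pose phi : measure dims R :=
  [ffun x : cell dims => [exists b : dom ell, x i == rep b]%:R].
have creates_phi (s : state dims R k) f :
    creates s (TSelectLevel k ell) f <-> f = phi.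
  by split=> [/creates_value //|->]; exact: CreateSelectLevel.
exists (OlapOperation (ts ++ ts0 ++ [seq TAdd dims (a j) z | j <- enum 'I_r])
          None (NewMeasure (TSelectLevel k ell))) => C C'.
have [ws [ytw uF]] := progF C [::] erefl.
have [ws0 [ytw0 [w0 zw w0E]]] := prog0 C ws ytw.1.
have [u au uE] : exists2 u : 'I_r -> measure dims R,
    forall j, lookup (cube_state C ws) (a j) = Some (u j)
  & forall j x, C x -> u j x = F j C x.
  by have [u] := fin_all_exists2 uF; exists u.
pose v (j : 'I_r) : measure dims R := [ffun x => u j x + w0 x].
have vE j x : C x -> v j x = F j C x.
  by move=> Cx; rewrite ffunE uE // w0E // rmorph0 addr0.
have [_ run] : yields C [::]
                 (ts ++ ts0 ++ [seq TAdd dims (a j) z | j <- enum 'I_r])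
                 (ws ++ ws0 ++ map v (enum 'I_r)).
  apply: yields_cat ytw (yields_cat ytw0 _); apply: yields_map => // j ws1 f.
  have aj := lookup_cat ws1 (lookup_cat ws0 (au j)).
  have z0 := lookup_cat ws1 zw.
  by split=> [/creates_value|->]; [exact | exact: CreateAdd].
move: run; set s := cube_state _ ([::] ++ _) => run.
have init_state : initial_state R C = cube_state C [::].
  by rewrite /cube_state cats0.
have size_s : (r <= size (st_computed s))%N.
  by rewrite /s /= !size_cat !size_map -!enumT !size_enum_ord !addnA leq_addl.
(* The r copies come last, so the offset points to the first of them. *)
have nth_s (j : 'I_r) :
    nth [ffun _ => 0] (st_computed s) (size (st_computed s) - r + j) = v j.
  rewrite /s /= !catA nth_cat [X in (X - r)%N]size_cat.
  rewrite [size (map v _)]size_map size_enum_ord addnK.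
  by rewrite ltnNge leq_addr /= addKn (nth_map j) ?size_enum_ord //
    nth_ord_enum.
clearbody s.
(* Existence of the output is shown first, then uniqueness. Without a destructor [delta] is
   constantly 1, so no cell is emptied. *)
split=> [[s' [delta [phi' [+ _ -> [/creates_phi-> _]]]]]|->]; last first.
  exists s, [ffun _ => 1], phi; split=> //.
  - by rewrite init_state; apply/run.
  - split; first exact/creates_phi.
    move=> x _; by rewrite ffunE; case: existsP; [right | left].
  move=> x; case Cx: (C x) => [c|]; last by rewrite ffunE Cx.
  rewrite ffunE oner_eq0; eexists; first by rewrite ffunE Cx.
  split=> [//|j|]; last by rewrite ffunE.
  by rewrite nth_s vE ?Cx // tnth_map.
rewrite init_state => /run-> out; apply/ffunP => x; have := out x.
case Cx: (C x) => [c|]; last by move->; rewrite ffunE Cx.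
rewrite ffunE oner_eq0 => -[[p t f] -> /= [-> t_eq f_eq]].
rewrite ffunE Cx /=; congr (Some (CellData _ _ _)).
  (* The embedding of the rationals into R is injective, so the value in R determines the output
     measure; likewise 0 and 1 differ in R, which determines the flag. *)
  apply: eq_from_tnth => j; have := t_eq j.
  by rewrite nth_s vE ?Cx // tnth_map => /fmorph_inj.
move: f_eq; rewrite ffunE; case: f; case: existsP => // _ /eqP.
  by rewrite oner_eq0.
by rewrite eq_sym oner_eq0.
Qed.
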